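(* Let $m\geqslant 92$ be an integer and let $G$ be a gem-free graph with exactly $m$ edges and without isolated vertices. Then $$\rho(G)\leqslant \begin{cases} \dfrac{1+\sqrt{4m-3}}{2}, & \text{if } m \text{ is odd},\\[2mm] \rho^*(m), & \text{if } m \text{ is even}.\end{cases}$$ Moreover, equality holds if and only if $$G\cong \begin{cases} S_{\frac{m+3}{2},2}, & \text{if } m \text{ is odd},\\[2mm] S_{\frac{m+4}{2},2}^{-1}, & \text{if } m \text{ is even}.\end{cases}$$
   Context: All graphs are finite and simple. The size of a graph is its number of edges. $\rho(G)$ denotes the spectral radius (largest eigenvalue) of the adjacency matrix of $G$. The gem is the graph $K_1\vee P_4$: a path on 4 vertices together with one additional vertex adjacent to every vertex of the path. A graph is gem-free if it does not contain the gem as a (not necessarily induced) subgraph. $S_{n,k}$ is the graph on $n$ vertices obtained by joining each vertex of the complete graph $K_k$ to $n-k$ isolated vertices, i.e. $S_{n,k}=K_k\vee (n-k)K_1$. $S_{n,2}^{-t}$ is the graph obtained from $S_{n,2}$ by deleting $t$ edges between one fixed vertex of degree $n-1$ and $t$ vertices of degree $2$; so $S_{n,2}^{-1}$ is $S_{n,2}$ with one edge between a vertex of degree $n-1$ and a vertex of degree $2$ removed. $\rho^*(m)$ denotes the largest real root of $x^4-mx^2-(m-2)x+\left(\frac{1}{2}m-1\right)=0$. *)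

(* Defs.v *)
From HB Require Import structures.
From mathcomp Require Import all_boot all_order all_algebra.
From mathcomp Require Import all_classical all_reals.

Set Implicit Arguments.
Unset Strict Implicit.
Unset Printing Implicit Defensive.

Import Order.TTheory GRing.Theory Num.Theory.

Local Open Scope ring_scope.

Record sgraph := SGraph {
  vertex :> finType;
  adj : rel vertex;
  adj_sym : symmetric adj;
  adj_irrefl : irreflexive adj
}.

Definition edges (G : sgraph) : {set {set G}} :=
  [set [set x; y] | x in G, y in G & adj x y].

Definition graph_size (G : sgraph) : nat := #|edges G|.

Definition no_isolated_vertex (G : sgraph) : Prop :=
  forall x : G, exists y : G, adj x y.

Definition graph_iso (G H : sgraph) : Prop :=
  exists2 f : G -> H, bijective f & forall x y : G, adj (f x) (f y) = adj x y.

(* Not necessarily induced: [f] only has to preserve edges. *)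
Definition has_subgraph (H G : sgraph) : Prop :=
  exists2 f : H -> G,
    injective f & forall x y : H, adj x y -> adj (f x) (f y).

Definition complete_adj (n : nat) : rel 'I_n := fun i j => i != j.

Lemma complete_adj_sym n : symmetric (@complete_adj n).
Proof. by move=> i j; rewrite /complete_adj eq_sym. Qed.

Lemma complete_adj_irrefl n : irreflexive (@complete_adj n).
Proof. by move=> i; rewrite /complete_adj eqxx. Qed.

Definition complete_graph (n : nat) : sgraph :=
  SGraph (@complete_adj_sym n) (@complete_adj_irrefl n).

Definition edgeless_adj (n : nat) : rel 'I_n := fun _ _ => false.

Lemma edgeless_adj_sym n : symmetric (@edgeless_adj n).
Proof. by []. Qed.

Lemma edgeless_adj_irrefl n : irreflexive (@edgeless_adj n).
Proof. by []. Qed.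

Definition edgeless_graph (n : nat) : sgraph :=
  SGraph (@edgeless_adj_sym n) (@edgeless_adj_irrefl n).

Definition path_adj (n : nat) : rel 'I_n :=
  fun i j => (i.+1 == j :> nat) || (j.+1 == i :> nat).

Lemma path_adj_sym n : symmetric (@path_adj n).
Proof. by move=> i j; rewrite /path_adj orbC. Qed.

Lemma path_adj_irrefl n : irreflexive (@path_adj n).
Proof. by move=> i; rewrite /path_adj orbb gtn_eqF. Qed.

(* The path has [n] vertices, not [n] edges. *)
Definition path_graph (n : nat) : sgraph :=
  SGraph (@path_adj_sym n) (@path_adj_irrefl n).

Definition join_adj (G H : sgraph) : rel (G + H)%type := fun u v =>
  match u, v with
  | inl x, inl y => adj x y
  | inr x, inr y => adj x y
  | _, _ => true
  end.

Lemma join_adj_sym G H : symmetric (@join_adj G H).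
Proof. by move=> [x|x] [y|y] //=; rewrite adj_sym. Qed.

Lemma join_adj_irrefl G H : irreflexive (@join_adj G H).
Proof. by move=> [x|x] /=; rewrite adj_irrefl. Qed.

Definition graph_join (G H : sgraph) : sgraph :=
  SGraph (@join_adj_sym G H) (@join_adj_irrefl G H).

Definition delete_adj (G : sgraph) (d : rel G) : rel G :=
  fun x y => adj x y && ~~ (d x y || d y x).

Lemma delete_adj_sym G d : symmetric (@delete_adj G d).
Proof. by move=> x y; rewrite /delete_adj adj_sym orbC. Qed.

Lemma delete_adj_irrefl G d : irreflexive (@delete_adj G d).
Proof. by move=> x; rewrite /delete_adj adj_irrefl. Qed.

Definition delete_edges (G : sgraph) (d : rel G) : sgraph :=
  SGraph (@delete_adj_sym G d) (@delete_adj_irrefl G d).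

Definition gem : sgraph := graph_join (complete_graph 1) (path_graph 4).

Definition gem_free (G : sgraph) : Prop := ~ has_subgraph gem G.

Definition S_graph (n k : nat) : sgraph :=
  graph_join (complete_graph k) (edgeless_graph (n - k)).

(* The edges deleted from [S_graph n 2] join vertex 0 of the clique to the
   first [t] vertices of the independent set; by symmetry of [S_graph n 2] any
   other choice gives an isomorphic graph. *)
Definition S2_minus (n t : nat) : sgraph :=
  @delete_edges (S_graph n 2) (fun u v =>
    match u, v with
    | inl i, inr j => (i == 0%N :> nat) && (j < t)%N
    | _, _ => false
    end).

(* The largest element of [A]; the value is 0 when there is none. *)
Definition largest (R : realType) (A : set R) : R := xget 0 (A `&` ubound A)%classic.

Definition adjacency_matrix (R : realType) (G : sgraph) : 'M[R]_#|G| :=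
  \matrix_(i, j) (adj (enum_val i) (enum_val j))%:R.

Definition spectral_radius (R : realType) (G : sgraph) : R :=
  largest [set a | eigenvalue (adjacency_matrix R G) a]%classic.

Definition rho_star_poly (R : realType) (m : nat) : {poly R} :=
  'X^4 - m%:R *: 'X^2 - (m%:R - 2) *: 'X + (m%:R / 2 - 1)%:P.

Definition rho_star (R : realType) (m : nat) : R :=
  largest [set x | root (rho_star_poly R m) x]%classic.

(* Main.v *)
Require Import Defs.
From HB Require Import structures.
From mathcomp Require Import all_boot all_order all_algebra.
From mathcomp Require Import all_classical all_reals.
From mathcomp Require Import ring lra zify.

Set Implicit Arguments.
Unset Strict Implicit.
Unset Printing Implicit Defensive.

Import Order.TTheory GRing.Theory Num.Theory.

Local Open Scope ring_scope.

(** Let l be an eigenvalue of G lying above the bound, and let x be the vector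
    of absolute values of an eigenvector, scaled so that its largest entry is
    x u = 1. Until the structure of G is known only the inequality l x <= A x is
    used, so neither a spectral theorem nor Perron-Frobenius theory enters, and
    G need not be connected.

    Write U for the neighbourhood of u and W for the vertices at distance at
    least two. Summing l x <= A x over U and comparing with an edge count gives
    [slack_inequality]: a sum of local defects is at most m - l^2 + l. As l lies
    above the bound, this is less than 3/2 ([rho_star_poly_ge0] does the even
    case). Since G is gem-free, the graph induced on U has no path on four
    vertices, so its components are triangles, single vertices and stars. Every
    triangle and every single vertex contributes a nonnegative defect, every
    star with at least two edges contributes at least 1.

    If there is no such star ([hub_neq0]), nearly all of the weight of U, which
    is at least l, lies on triangles with weights close to 1. Such vertices need
    about l neighbours each, mostly in W; a vertex of W sees at most one vertex
    of each triangle, so its weight is near 1 only when there are about l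
    triangles, and then G has about 3 l^2 edges, far more than l^2.

    So there is exactly one star, and all remaining defects together are below
    1/2. Then W carries no edge; a vertex of W would have weight near 1, hence
    see nearly all of the weight of U, the centre c and leaves of the star
    included, which creates a gem ([far_empty]). Without W the triangles have
    too little weight ([book_structure]). Therefore G is a book, that is the
    triangles sharing the edge uc, together with t pendant edges at u:
    G is S2_minus (k + t + 2) t with m = 2 k + t + 1 ([book_iso]).

    The positive eigenvalues of S2_minus are the positive roots of an explicit
    quartic ([S2_minus_eigenvalue]). It leaves t = 0 for odd m, and t = 1 for
    even m because t is odd and t >= 3 is numerically impossible; in both cases
    l equals the bound. Applying this to any eigenvalue shows that the bound
    dominates the spectrum; that it is attained by the extremal graph is the
    same quartic read backwards ([extremal_eigenvalue]). *)

(** * Counting edges around a vertex *)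

Definition nbr (G : sgraph) (A : {set G}) (v : G) : {set G} :=
  [set y in A | adj v y].

Definition nbhd (G : sgraph) (u : G) : {set G} := [set y | adj u y].

Definition far (G : sgraph) (u : G) : {set G} :=
  [set w | (w != u) && ~~ adj u w].

Lemma in_nbr (G : sgraph) (A : {set G}) (v y : G) :
  (y \in nbr A v) = (y \in A) && adj v y.
Proof. by rewrite inE. Qed.

Lemma in_nbhd (G : sgraph) (u y : G) : (y \in nbhd u) = adj u y.
Proof. by rewrite inE. Qed.

(** Double counting: every edge is the image of exactly two ordered pairs of
    adjacent vertices. *)
Lemma sum_adj_nat (G : sgraph) :
  (\sum_(v : G) #|nbhd v| = 2 * graph_size G)%N.
Proof.
pose P := [set p : G * G | adj p.1 p.2].
pose f (p : G * G) := [set p.1; p.2].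
have Pcard : (\sum_(v : G) #|nbhd v| = #|P|)%N.
  rewrite -sum1_card.
  rewrite (eq_bigl (fun p : G * G => xpredT p.1 && adj p.1 p.2)); last first.
    by move=> p; rewrite inE.
  rewrite -(pair_big_dep xpredT (fun x y => adj x y) (fun _ _ => 1%N)) /=.
  by apply: eq_bigr => v _; rewrite -sum1_card; apply: eq_bigl => y; rewrite inE.
have fP : edges G = f @: P.
  apply/setP => e; apply/imset2P/imsetP.
    case=> x y _; rewrite inE => /andP[_ xy] ->.
    by exists (x, y); rewrite ?inE.
  by case=> -[x y]; rewrite inE /= => xy ->; exists x y; rewrite ?inE.
rewrite Pcard -sum1_card (partition_big_imset f) -fP /=.
rewrite (eq_bigr (fun _ => 2%N)); first by rewrite sum_nat_const mulnC.
move=> e; rewrite fP => /imsetP[[x y]]; rewrite inE /= => xy ->.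
have nxy : x != y by apply/eqP => E; rewrite E adj_irrefl in xy.
have E2 : #|[set (x, y); (y, x)]| = 2%N.
  by rewrite cards2; case: eqP => // -[/eqP]; rewrite (negbTE nxy).
rewrite -[RHS]E2 -sum1_card; apply: eq_bigl => -[a b].
rewrite !inE /f /= !xpair_eqE; apply/andP/orP.
  move=> [ab /eqP E]; have nab : a != b.
    by apply/eqP => ab'; rewrite ab' adj_irrefl in ab.
  have : a \in [set x; y] by rewrite -E set21.
  have : b \in [set x; y] by rewrite -E set22.
  rewrite !inE => /orP[]/eqP bE /orP[]/eqP aE; subst a b.
  - by rewrite eqxx in nab.
  - by right; rewrite !eqxx.
  - by left; rewrite !eqxx.
  - by rewrite eqxx in nab.
case=> /andP[/eqP-> /eqP->]; split => //; first by rewrite adj_sym.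
by rewrite finset.setUC.
Qed.

Section WeightedCounting.

Variables (R : realFieldType) (G : sgraph).
Implicit Types (A B : {set G}) (u v w : G) (F : G -> R).

Definition deg A v : R := #|nbr A v|%:R.

Lemma sum_nbr_exchange A B F :
  \sum_(v in A) \sum_(y in nbr B v) F y =
  \sum_(y in B) deg A y * F y.
Proof.
rewrite (exchange_big_dep (mem B)) /=; last by move=> v y _; rewrite in_nbr => /andP[].
apply: eq_bigr => y By; rewrite mulr_natl -sumr_const.
by apply: eq_bigl => v; rewrite !in_nbr By adj_sym.
Qed.

Lemma sum_split u F :
  \sum_v F v = F u + \sum_(v in nbhd u) F v + \sum_(w in far u) F w.
Proof.
rewrite (bigD1 u) //= -addrA (bigID (adj u)) /=; congr (_ + (_ + _)).
  apply: eq_bigl => v; rewrite in_nbhd andbC.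
  by case: eqP => [->|]; rewrite ?adj_irrefl ?andbT.
by apply: eq_bigl => v; rewrite inE.
Qed.

Lemma sum_nbhd_split u v F :
  \sum_(y in nbhd v) F y =
  (adj u v)%:R * F u + \sum_(y in nbr (nbhd u) v) F y
  + \sum_(y in nbr (far u) v) F y.
Proof.
rewrite big_mkcond (sum_split u) /= in_nbhd adj_sym; congr (_ + _ + _).
- by case: adj; rewrite ?mul1r ?mul0r.
- by rewrite -big_mkcondr; apply: eq_bigl => y; rewrite in_nbr !in_nbhd.
- by rewrite -big_mkcondr; apply: eq_bigl => y; rewrite in_nbr !in_nbhd.
Qed.

Lemma size_split u :
  (graph_size G)%:R = #|nbhd u|%:R
    + (\sum_(v in nbhd u) deg (nbhd u) v) / 2
    + \sum_(w in far u) deg (nbhd u) w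
    + (\sum_(w in far u) deg (far u) w) / 2 :> R.
Proof.
have cardE A : #|A|%:R = \sum_(v in A) 1 :> R by rewrite sumr_const.
have H : 2 * (graph_size G)%:R = \sum_(v : G) #|nbhd v|%:R :> R.
  by rewrite -natrM -(sum_adj_nat G) natr_sum.
have dE v : #|nbhd v|%:R = (adj u v)%:R + deg (nbhd u) v
    + deg (far u) v :> R.
  by rewrite cardE (sum_nbhd_split u) -!cardE mulr1.
have HU : \sum_(v in nbhd u) #|nbhd v|%:R = #|nbhd u|%:R +
    \sum_(v in nbhd u) deg (nbhd u) v
    + \sum_(w in far u) deg (nbhd u) w :> R.
  rewrite (eq_bigr _ (fun v _ => dE v)) !big_split /= cardE.
  congr (_ + _ + _); first by apply: eq_bigr => v; rewrite in_nbhd => ->.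
  rewrite -(eq_bigr _ (fun v _ => esym (cardE (nbr _ v)))) sum_nbr_exchange.
  by apply: eq_bigr => v _; rewrite mulr1.
have HW : \sum_(w in far u) #|nbhd w|%:R =
    \sum_(w in far u) deg (nbhd u) w +
    \sum_(w in far u) deg (far u) w :> R.
  rewrite -big_split /=; apply: eq_bigr => w; rewrite inE => /andP[_ /negbTE uw].
  by rewrite dE uw add0r.
move: H; rewrite (sum_split u) HU HW.
set a := #|_|%:R; set b := \sum_(v in nbhd u) _.
set c := \sum_(v in far u) _; set d := \sum_(v in far u) _; lra.
Qed.

Definition subeigen (l : R) (x : G -> R) :=
  forall v, l * x v <= \sum_(y in nbhd v) x y.

(** Multiplying by l the inequality at u and inserting the ones at its
    neighbours bounds l^2 by the weights of walks of length two from u; the edge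
    count of [size_split] is then subtracted. Regrouped by the components
    of the neighbourhood, the left side is a sum of nonnegative defects. *)
Lemma slack_inequality (l : R) (x : G -> R) u :
  1 <= l -> x u = 1 -> subeigen l x ->
  (l - 1) * (\sum_(v in nbhd u) x v - l)
  + \sum_(v in nbhd u) (deg (nbhd u) v / 2 - (deg (nbhd u) v - 1) * x v)
  + \sum_(w in far u) deg (nbhd u) w * (1 - x w)
  + (\sum_(w in far u) deg (far u) w) / 2
  <= (graph_size G)%:R - l ^+ 2 + l.
Proof.
move=> l1 xu lx.
have lX : l * \sum_(v in nbhd u) x v <= #|nbhd u|%:R
    + \sum_(v in nbhd u) deg (nbhd u) v * x v + \sum_(w in far u) deg (nbhd u) w * x w.
  rewrite mulr_sumr.
  apply: (le_trans (ler_sum _ (fun v _ => lx v))).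
  rewrite (eq_bigr _ (fun v _ => sum_nbhd_split u v x)) !big_split /= xu.
  rewrite !sum_nbr_exchange lerD2r lerD2r -sumr_const.
  by apply: ler_sum => v; rewrite in_nbhd => ->; rewrite mulr1.
rewrite (size_split u).
have -> : \sum_(v in nbhd u) (deg (nbhd u) v / 2 - (deg (nbhd u) v - 1) * x v) =
  (\sum_(v in nbhd u) deg (nbhd u) v) / 2 - \sum_(v in nbhd u) deg (nbhd u) v * x v
  + \sum_(v in nbhd u) x v.
  rewrite mulr_suml -sumrB -big_split; apply: eq_bigr => v _ /=; ring.
have -> : \sum_(w in far u) deg (nbhd u) w * (1 - x w) =
  \sum_(w in far u) deg (nbhd u) w - \sum_(w in far u) deg (nbhd u) w * x w.
  by rewrite -sumrB; apply: eq_bigr => v _; ring.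
move: lX; rewrite -!/(deg _ _).
set X := \sum_(v in nbhd u) x v; set a := #|_|%:R.
set b := \sum_(v in nbhd u) deg (nbhd u) v; set c := \sum_(v in nbhd u) deg (nbhd u) v * x v.
set e := \sum_(v in far u) deg (nbhd u) v * x v; set f := \sum_(v in far u) deg (nbhd u) v.
set g := \sum_(v in far u) _; nra.
Qed.

End WeightedCounting.

(** * Local structure of a gem-free graph *)

Section GemFree.

Variable G : sgraph.
Hypothesis gemG : gem_free G.
Implicit Types (u v w a b c e : G).

Lemma adj_neq a b : adj a b -> a != b.
Proof. by move=> ab; apply/eqP => E; rewrite E adj_irrefl in ab. Qed.

(** The form in which gem-freeness is used: u is joined to the path a b c e. *)
Lemma no_gem u a b c e :
  adj u a -> adj u b -> adj u c -> adj u e ->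
  adj a b -> adj b c -> adj c e -> a != c -> a != e -> b != e -> False.
Proof.
move=> ua ub uc ue ab bc ce ac ae be; apply: gemG.
have [nua nub nuc nue] := And4 (adj_neq ua) (adj_neq ub) (adj_neq uc) (adj_neq ue).
have [nab nbc nce] := And3 (adj_neq ab) (adj_neq bc) (adj_neq ce).
pose s := [:: a; b; c; e].
pose f (z : gem) : G := match z with inl _ => u | inr i => nth u s i end.
have us : uniq s by rewrite /= !inE !negb_or nab ac ae nbc be nce.
have sP (i : 'I_4) : adj u (nth u s i).
  by case: i => [[|[|[|[|?]]]] ?].
exists f.
  move=> [i|i] [j|j] /=; rewrite ?[i]ord1 ?[j]ord1 //.
  - by move=> E; have := sP j; rewrite -E adj_irrefl.
  - by move=> E; have := sP i; rewrite E adj_irrefl.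
  by move=> /eqP; rewrite nth_uniq // => /eqP/val_inj->.
move=> [i|i] [j|j] //=.
- by rewrite /complete_adj [i]ord1 [j]ord1 eqxx.
- by rewrite adj_sym.
have st k : (k.+1 < 4)%N -> adj (nth u s k) (nth u s k.+1).
  by case: k => [|[|[|]]].
rewrite /path_adj => /orP[/eqP E|/eqP E].
  by rewrite -E; apply: st; rewrite E.
by rewrite -E adj_sym; apply: st; rewrite E.
Qed.

(** Otherwise c is joined to the path w l u z. *)
Lemma far_misses_edge u w c l z :
  w \in far u -> l \in nbhd u -> c \in nbhd u -> z \in nbhd u ->
  adj c l -> adj c z -> z != l -> adj w c -> ~~ adj w l.
Proof.
rewrite !inE => /andP[wu uw] ul uc uz cl cz zl wc; apply/negP => wl.
apply: (@no_gem c w l u z) => //; rewrite 1?adj_sym // 1?eq_sym //.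
by apply/eqP => E; rewrite -E uz in uw.
Qed.

Lemma card_ge2P (A : {set G}) :
  (1 < #|A|)%N -> exists y z, [/\ y \in A, z \in A & y != z].
Proof. by move/card_gt1P => [y [z []]]; exists y, z. Qed.

Definition in_triangle u v :=
  [exists y in nbr (nbhd u) v, exists z in nbr (nbhd u) v, adj y z].

Lemma in_triangleP u v :
  reflect (exists y z, [/\ y \in nbr (nbhd u) v, z \in nbr (nbhd u) v & adj y z])
          (in_triangle u v).
Proof.
apply: (iffP existsP) => [[y /andP[vy /existsP[z /andP[vz yz]]]]|[y [z [vy vz yz]]]].
  by exists y, z.
by exists y; rewrite vy; apply/existsP; exists z; rewrite vz.
Qed.

(** A further neighbour q of v would give the path q v y z inside the
    neighbourhood of u. *)
Lemma triangle_nbr u v y z : v \in nbhd u ->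
  y \in nbr (nbhd u) v -> z \in nbr (nbhd u) v -> adj y z ->
  nbr (nbhd u) v = [set y; z].
Proof.
rewrite !inE => uv /andP[uy vy] /andP[uz vz] yz.
apply/setP => q; rewrite !inE.
apply/idP/idP => [/andP[uq vq]|/orP[]/eqP->]; last 2 first.
- by rewrite uy.
- by rewrite uz.
apply: contraT; rewrite negb_or => /andP[qy qz]; exfalso.
apply: (@no_gem u q v y z) => //; rewrite 1?adj_sym //.
exact: adj_neq.
Qed.

Lemma triangle_deg u v : v \in nbhd u -> in_triangle u v ->
  #|nbr (nbhd u) v| = 2%N.
Proof.
move=> uv /in_triangleP[y [z [vy vz yz]]].
by rewrite (triangle_nbr uv vy vz yz) cards2 (adj_neq yz).
Qed.

Lemma triangle_closed u v y : v \in nbhd u -> in_triangle u v ->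
  y \in nbr (nbhd u) v -> in_triangle u y.
Proof.
move=> uv /in_triangleP[a [b [va vb ab]]] vy.
have ba : adj b a by rewrite adj_sym.
move: vy; rewrite (triangle_nbr uv va vb ab) !inE => /orP[]/eqP->;
  apply/in_triangleP; rewrite !inE in uv va vb *; case/andP: va => ua va;
  case/andP: vb => ub vb.
  by exists v, b; rewrite !inE uv ub ab vb adj_sym va.
by exists v, a; rewrite !inE uv ua ba va adj_sym vb.
Qed.

(** A further neighbour of l would give a triangle at c or a path on four
    vertices through l and c. *)
Lemma star_leaf u c l : c \in nbhd u -> ~~ in_triangle u c ->
  (1 < #|nbr (nbhd u) c|)%N -> l \in nbr (nbhd u) c ->
  nbr (nbhd u) l = [set c].
Proof.
move=> uc cT c2 cl.
have [z cz zl] : exists2 z, z \in nbr (nbhd u) c & z != l.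
  have [y [z [cy cz yz]]] := card_ge2P c2.
  by case: (eqVneq y l) => [E|]; [exists z; rewrite // -E eq_sym | exists y].
apply/setP => q; rewrite !inE; apply/andP/eqP => [[uq lq]|->]; last first.
  by rewrite !inE in uc cl; case/andP: cl => _; rewrite adj_sym.
apply/eqP; apply: contraT => qc; exfalso.
move: (uc) (cl) (cz); rewrite !inE => uc' /andP[ul cl'] /andP[uz cz'].
case: (eqVneq q z) => [E|qz].
  case/negP: cT; apply/in_triangleP; exists l, z; split => //; by rewrite -E.
apply: (@no_gem u q l c z) => //; rewrite 1?adj_sym // 1?eq_sym //.
Qed.

Lemma star_leaf_not_triangle u l c : nbr (nbhd u) l = [set c] ->
  ~~ in_triangle u l.
Proof.
move=> lc; apply/negP => /in_triangleP[y [z]].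
by rewrite lc !inE => -[/eqP-> /eqP->]; rewrite adj_irrefl.
Qed.

(** By [far_misses_edge], a far vertex cannot see two vertices of a triangle
    of the neighbourhood of u. *)
Lemma far_triangle_nbrs u w v :
  w \in far u -> v \in nbhd u -> in_triangle u v ->
  (#|[set y in nbhd u | adj w y & (y == v) || adj v y]| <= 1)%N.
Proof.
move=> wW uv /in_triangleP[a [b [va vb ab]]].
have N := triangle_nbr uv va vb ab.
rewrite leqNgt; apply/negP => /card_ge2P[y [z]].
have key c l q : c \in nbhd u -> l \in nbhd u -> q \in nbhd u ->
   adj c l -> adj c q -> adj l q -> ~~ (adj w c && adj w l).
  move=> uc ul uq cl cq lq; apply/andP => -[wc wl].
  have := far_misses_edge wW ul uc uq cl cq _ wc.
  by rewrite wl eq_sym (adj_neq lq) => /(_ isT).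
have uv' := uv.
move: (va) (vb); rewrite !in_nbr => /andP[ua va'] /andP[ub vb'].
have [av bv ba] : [/\ adj a v, adj b v & adj b a] by rewrite ![adj _ v]adj_sym [adj b a]adj_sym.
have nvP q : (q == v) || adj v q -> q \in nbhd u -> q \in [:: v; a; b].
  move=> H uq; rewrite !inE; case/orP: H => [->//|vq].
  have : q \in nbr (nbhd u) v by rewrite in_nbr uq.
  by rewrite N !inE => ->; rewrite orbT.
rewrite !inE => -[/and3P[uy wy yv] /and3P[uz wz zv] yz].
have := nvP y yv; have := nvP z zv; rewrite !inE => /(_ uz) zE /(_ uy) yE.
have K1 := key _ _ _ uv ua ub va' vb' ab.
have K2 := key _ _ _ uv ub ua vb' va' ba.
have K3 := key _ _ _ ua ub uv ab av bv.
case/or3P: yE => /eqP yE; case/or3P: zE => /eqP zE; subst y z;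
  move: K1 K2 K3; rewrite ?wy ?wz // => *; by rewrite eqxx in yz.
Qed.

End GemFree.

(** * The neighbourhood of a vertex of maximum weight *)

(** The neighbourhood of u is divided according to the component of the induced
    graph: triangles ([tri]), single vertices ([lone]), and stars. In a star with
    at least two edges the centre is in [hub] and the other vertices in [leaf];
    both ends of a star with one edge are in [leaf]. *)
Definition tri (G : sgraph) (u : G) : {set G} :=
  [set v in nbhd u | in_triangle u v].

Definition lone (G : sgraph) (u : G) : {set G} :=
  [set v in nbhd u | #|nbr (nbhd u) v| == 0%N].

Definition leaf (G : sgraph) (u : G) : {set G} :=
  [set v in nbhd u | ~~ in_triangle u v & #|nbr (nbhd u) v| == 1%N].

Definition hub (G : sgraph) (u : G) : {set G} :=
  [set v in nbhd u | ~~ in_triangle u v & (1 < #|nbr (nbhd u) v|)%N].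

Section Neighbourhood.

Variables (R : realFieldType) (G : sgraph) (u : G).
Hypothesis gemG : gem_free G.

Lemma sum_nbhd_classes (F : G -> R) :
  \sum_(v in nbhd u) F v = \sum_(v in tri u) F v + \sum_(v in lone u) F v
    + \sum_(v in leaf u) F v + \sum_(v in hub u) F v.
Proof.
rewrite (bigID (in_triangle u)) /= -!addrA; congr (_ + _).
  by apply: eq_bigl => v; rewrite !inE.
rewrite (bigID (fun v => #|nbr (nbhd u) v| == 0%N)) /=; congr (_ + _).
  apply: eq_bigl => v; rewrite !inE -andbA; case: (boolP (adj u v)) => //= uv.
  case: (boolP (in_triangle u v)) => //= vT; rewrite triangle_deg ?in_nbhd //.
rewrite (bigID (fun v => #|nbr (nbhd u) v| == 1%N)) /=.
congr (_ + _); apply: eq_bigl => v; rewrite !inE -!andbA; do 2!congr (_ && _);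
  by case: #|_| => [|[]].
Qed.

Lemma cost_split (x : G -> R) :
  \sum_(v in nbhd u) (deg R (nbhd u) v / 2 - (deg R (nbhd u) v - 1) * x v)
  = \sum_(v in tri u) (1 - x v) + \sum_(v in lone u) x v + #|leaf u|%:R / 2
    + \sum_(c in hub u) (deg R (nbhd u) c / 2 - (deg R (nbhd u) c - 1) * x c).
Proof.
rewrite sum_nbhd_classes; congr (_ + _ + _ + _).
- apply: eq_bigr => v; rewrite inE => /andP[uv vT].
  by rewrite /deg triangle_deg //; lra.
- apply: eq_bigr => v; rewrite inE /deg => /andP[_ /eqP->]; lra.
rewrite -sumr_const mulr_suml.
apply: eq_bigr => v; rewrite inE /deg => /and3P[_ _ /eqP->]; lra.
Qed.

Lemma hub_leaf c y : c \in hub u -> y \in nbr (nbhd u) c -> y \in leaf u.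
Proof.
rewrite inE => /and3P[uc cT c2] cy.
have yc := star_leaf gemG uc cT c2 cy.
move: cy; rewrite in_nbr => /andP[uy _].
by rewrite inE uy (star_leaf_not_triangle yc) yc cards1.
Qed.

(** A leaf has a single neighbour, so it is counted for at most one hub.
    The excess counts the ends of the one-edge stars. *)
Lemma hub_leaf_count : \sum_(c in hub u) deg R (nbhd u) c <= #|leaf u|%:R.
Proof.
have -> : \sum_(c in hub u) deg R (nbhd u) c =
    \sum_(y in nbhd u) deg R (hub u) y.
  transitivity (\sum_(c in hub u) \sum_(y in nbr (nbhd u) c) (1 : R)).
    by apply: eq_bigr => c _; rewrite sumr_const.
  by rewrite sum_nbr_exchange; apply: eq_bigr => y _; rewrite mulr1.
rewrite -sumr_const (big_setID (leaf u)) /= [X in _ + X]big1; last first.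
  move=> y; rewrite inE => /andP[yL uy]; rewrite /deg; apply/eqP.
  rewrite pnatr_eq0 cards_eq0; apply: contraR yL => /set0Pn[c].
  rewrite in_nbr => /andP[cB yc]; apply: (hub_leaf cB).
  by rewrite in_nbr uy adj_sym.
rewrite addr0.
have -> : nbhd u :&: leaf u = leaf u.
  by apply/setP => v; rewrite !inE; case: (adj u v).
apply: ler_sum => y; rewrite inE /deg => /and3P[_ _ /eqP y1].
rewrite lern1 -y1; apply: subset_leq_card; apply/fintype.subsetP => c.
by rewrite !inE => /andP[/andP[-> _] ->].
Qed.

(** The triangles through the neighbours of w are pairwise disjoint, so the
    closed neighbourhoods of these neighbours, of three vertices each, fit into
    [tri]. *)
Lemma far_tri_nbr w : w \in far u -> (3 * #|nbr (tri u) w| <= #|tri u|)%N.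
Proof.
move=> wW; rewrite mulnC -sum_nat_const.
pose C y := [set v in nbhd u | (v == y) || adj y v].
have C3 y : y \in tri u -> (3 = \sum_(v in tri u) (v \in C y))%N.
  rewrite inE => /andP[uy yT].
  have CE : C y = y |: nbr (nbhd u) y.
    apply/setP => v; rewrite !inE andb_orr; congr (_ || _).
    by case: eqP => [->|]; rewrite ?andbF // -in_nbhd uy.
  have : #|C y| = 3%N.
    by rewrite CE cardsU1 triangle_deg // !inE adj_irrefl andbF.
  move=> <-; rewrite -sum1_card big_mkcond [RHS]big_mkcond; apply: eq_bigr => v _.
  case: (boolP (v \in C y)) => [vC|_]; last by rewrite if_same.
  rewrite inE; move: (vC); rewrite inE => /andP[uv /orP[/eqP->|yv]].
    by rewrite uy yT.
  by rewrite uv (triangle_closed gemG uy yT) // in_nbr uv.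
have -> : (\sum_(y in nbr (tri u) w) 3 =
    \sum_(y in nbr (tri u) w) \sum_(v in tri u) (v \in C y))%N.
  by apply: eq_bigr => y; rewrite in_nbr => /andP[/C3].
rewrite exchange_big /= -sum1_card; apply: leq_sum => v; rewrite inE => /andP[uv vT].
apply: leq_trans (far_triangle_nbrs gemG wW uv vT).
rewrite -sum1_card big_mkcond [X in (_ <= X)%N]big_mkcond; apply: leq_sum => y _.
rewrite !inE; case: (boolP (adj u y)) => //= uy.
move: uv; rewrite in_nbhd => ->; case: (in_triangle u y) => //=.
by rewrite [v == y]eq_sym [adj y v]adj_sym; case: (adj w y) => //=; case: (_ || _).
Qed.

End Neighbourhood.

(** * The spectral inequality forces a book with pendant edges *)

(** Here n is the number of triangle vertices, E the number of edges between
    the neighbourhood and the far vertices, Y the same edges weighted by their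
    far end, and A, Z, H, E - Y, D the defects. The lower bounds on n and E
    reinforce each other until n is about 3 l, and E + 2 n exceeds m. *)
Lemma no_hub_arithmetic (R : realFieldType) (l n A Z H E Y X D m : R) :
  10 <= l -> 0 <= A -> 0 <= Z -> 0 <= H -> 0 <= E - Y -> 0 <= D ->
  l <= X -> A + Z + H + (E - Y) + D < 3 / 2 ->
  X <= n + Z + 2 * H -> l * (n - A) <= 3 * n + E ->
  l * Y <= E * (n / 3 + 3) -> 2 * n + E <= m -> m < l ^+ 2 - l + 3 / 2 ->
  False.
Proof.
move=> l10 A0 Z0 H0 D0 W0 lX sl Xn nE YE mE ml.
have n_low : l - 3 <= n by lra.
have lA : l * A <= l * (3 / 2) by apply: ler_wpM2l; lra.
have E_low : (l - 3) * n - 3 / 2 * l <= E by lra.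
have n2 : (l - 3) * (l - 3) <= (l - 3) * n by apply: ler_wpM2l; lra.
(* This is where l >= 10 is needed: (l - 3)^2 >= 9 l / 2. *)
have E3l : 3 * l <= E by nra.
(* Far ends of edges have average weight at least 1 - 3 / (2 E), and no weight
   there exceeds (n / 3 + 3) / l. *)
have n3 : 3 * l - 21 / 2 <= n.
  rewrite leNgt; apply/negP => nl.
  have H1 : E * (n / 3 + 3) < E * (l - 1 / 2) by rewrite ltr_pM2l; lra.
  have H2 : l * (E - 3 / 2) <= l * Y by apply: ler_wpM2l; lra.
  lra.
have H3 : (l - 1) * (3 * l - 21 / 2) <= (l - 1) * n by apply: ler_wpM2l; lra.
nra.
Qed.

Section DominantVertex.

Variables (R : realFieldType) (G : sgraph) (l : R) (x : G -> R) (u : G).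
Hypothesis gemG : gem_free G.
Hypothesis isoG : no_isolated_vertex G.
Hypothesis l10 : 10 <= l.
Hypothesis x0 : forall v, 0 <= x v.
Hypothesis x1 : forall v, x v <= 1.
Hypothesis xu : x u = 1.
Hypothesis lx : subeigen l x.
Hypothesis sizeG : (graph_size G)%:R < l ^+ 2 - l + 3 / 2.

Local Notation X := (\sum_(v in nbhd u) x v).
Local Notation defectT := (\sum_(v in tri u) (1 - x v)).
Local Notation defectZ := (\sum_(v in lone u) x v).
Local Notation degU v := (deg R (nbhd u) v).
Local Notation defectW := (\sum_(w in far u) degU w * (1 - x w)).
Local Notation edgesW := (\sum_(w in far u) deg R (far u) w).

Lemma deg_ge0 A (v : G) : 0 <= deg R A v.
Proof. exact: ler0n. Qed.

Lemma weight_nbhd_ge : l <= X.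
Proof. by have := lx u; rewrite xu mulr1. Qed.

Lemma defectT_ge0 : 0 <= defectT.
Proof. by apply: sumr_ge0 => v _; rewrite subr_ge0. Qed.

Lemma defectZ_ge0 : 0 <= defectZ.
Proof. exact: sumr_ge0. Qed.

Lemma defectW_ge0 : 0 <= defectW.
Proof. by apply: sumr_ge0 => v _; rewrite mulr_ge0 ?deg_ge0 ?subr_ge0. Qed.

Lemma edgesW_ge0 : 0 <= edgesW.
Proof. by apply: sumr_ge0 => v _; rewrite deg_ge0. Qed.

Lemma total_slack :
  (l - 1) * (X - l) + defectT + defectZ + #|leaf u|%:R / 2
  + \sum_(c in hub u) (degU c / 2 - (degU c - 1) * x c)
  + defectW + edgesW / 2 < 3 / 2.
Proof.
have l1 : 1 <= l by move: l10; lra.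
have := slack_inequality l1 xu lx; rewrite cost_split // => H.
move: H sizeG; set a := (l - 1) * _; lra.
Qed.

Lemma sum_le_card (A : {set G}) : \sum_(v in A) x v <= #|A|%:R.
Proof. by rewrite -sumr_const; apply: ler_sum => v _. Qed.

Lemma weight_far w : w \in far u ->
  l * x w <= \sum_(y in nbr (nbhd u) w) x y + deg R (far u) w.
Proof.
rewrite inE => /andP[_ /negbTE uw].
apply: (le_trans (lx w)); rewrite (sum_nbhd_split u) uw mul0r add0r lerD2l.
exact: sum_le_card.
Qed.

Lemma weight_nbr_classes w :
  \sum_(y in nbr (nbhd u) w) x y <=
  #|nbr (tri u) w|%:R + defectZ + \sum_(y in nbr (leaf u) w) x y
  + \sum_(y in nbr (hub u) w) x y.
Proof.
have E (A : {set G}) : \sum_(y in nbr A w) x y =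
    \sum_(y in A) (if adj w y then x y else 0).
  by rewrite -big_mkcondr; apply: eq_bigl => y; rewrite in_nbr.
rewrite !E sum_nbhd_classes // !lerD2r lerD //.
  by rewrite -E sum_le_card.
by apply: ler_sum => y _; case: ifP.
Qed.

Lemma deg_far_le w : w \in far u -> deg R (far u) w <= edgesW.
Proof.
move=> wW; rewrite (bigD1 w) //= lerDl.
by apply: sumr_ge0 => v _; rewrite deg_ge0.
Qed.

(** Otherwise the triangles have to carry nearly all of the weight of the
    neighbourhood, which takes more edges than there are. *)
Lemma hub_neq0 : hub u != finset.set0.
Proof.
apply/eqP => hub0.
pose n : R := #|tri u|%:R.
pose H : R := #|leaf u|%:R / 2.
pose E : R := \sum_(w in far u) degU w.
pose Y : R := \sum_(w in far u) degU w * x w.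
have H0 : 0 <= H by rewrite /H divr_ge0.
have W0 := edgesW_ge0.
have DE : defectW = E - Y.
  by rewrite -sumrB; apply: eq_bigr => v _; ring.
have DE0 := defectW_ge0; have T0 := defectT_ge0; have Z0 := defectZ_ge0.
have lX := weight_nbhd_ge.
have sl := total_slack; rewrite hub0 big_set0 addr0 DE -/H in sl.
have lX0 : 0 <= (l - 1) * (X - l) by rewrite mulr_ge0; move: l10 lX; lra.
rewrite DE in DE0.
have W2 : 0 <= edgesW / 2 by rewrite divr_ge0.
have sl' : defectT + defectZ + H + (E - Y) + edgesW / 2 < 3 / 2.
  by move: sl lX0; set a := (l - 1) * _; lra.
apply: (@no_hub_arithmetic R l n defectT defectZ H E Y X (edgesW / 2)
         (graph_size G)%:R) => //.
- rewrite sum_nbhd_classes // hub0 big_set0 addr0 /H mulrC divfK ?pnatr_eq0 //.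
  by rewrite lerD ?sum_le_card // lerD2r sum_le_card.
- have -> : n - defectT = \sum_(v in tri u) x v.
    by rewrite sumrB sumr_const /n; ring.
  rewrite mulr_sumr; apply: (le_trans (ler_sum _ (fun v _ => lx v))).
  rewrite (eq_bigr _ (fun v _ => sum_nbhd_split u v x)) !big_split /=.
  apply: lerD.
    rewrite -big_split /= /n -sumr_const mulr_sumr; apply: ler_sum => v.
    rewrite inE => /andP[uv vT]; rewrite -in_nbhd uv xu mulr1 /=.
    have := sum_le_card (nbr (nbhd u) v); rewrite triangle_deg //; lra.
  rewrite sum_nbr_exchange; apply: ler_sum => w _.
  apply: (@le_trans _ _ (deg R (tri u) w * 1)).
    by rewrite ler_wpM2l ?deg_ge0.
  rewrite mulr1 ler_nat; apply: subset_leq_card; apply/fintype.subsetP => y.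
  by rewrite !inE => /andP[/andP[-> _] ->].
- rewrite mulr_sumr mulr_suml; apply: ler_sum => w wW.
  rewrite mulrCA ler_wpM2l ?deg_ge0 //.
  have := weight_far wW; have := weight_nbr_classes w; have := deg_far_le wW.
  have : nbr (hub u) w = finset.set0 by apply/setP => y; rewrite hub0 !inE.
  move=> ->; rewrite big_set0.
  have : \sum_(y in nbr (leaf u) w) x y <= 2 * H.
    rewrite /H mulrC divfK ?pnatr_eq0 //.
    apply: (le_trans (sum_le_card _)); rewrite ler_nat subset_leq_card //.
    by apply/fintype.subsetP => y; rewrite in_nbr => /andP[].
  have : 3 * #|nbr (tri u) w|%:R <= n by rewrite -natrM ler_nat far_tri_nbr.
  move: sl' T0 Z0 H0 DE0 W0.
  set s := \sum_(v in nbr (nbhd u) w) _; set a := #|nbr _ _|%:R.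
  by set e := \sum_(v in nbr (leaf u) w) _; lra.
rewrite (size_split R u) -/E.
have U1 : n <= #|nbhd u|%:R.
  by rewrite ler_nat subset_leq_card //; apply/fintype.subsetP => y; rewrite inE => /andP[].
have U2 : 2 * n <= \sum_(v in nbhd u) degU v.
  rewrite sum_nbhd_classes // -!addrA /n -sumr_const mulr_sumr.
  apply: (@le_trans _ _ (\sum_(v in tri u) degU v)).
    apply: ler_sum => v; rewrite inE => /andP[uv vT].
    by rewrite /deg triangle_deg // mulr1.
  by rewrite lerDl !addr_ge0 // sumr_ge0 // => v _; rewrite deg_ge0.
move: U1 U2 W2; set a := \sum_(v in nbhd u) _; lra.
Qed.

(** Each hub c costs 1 + (deg c - 1)(1 - x c) once it is charged for its
    leaves, so only one hub fits into a total slack below 3/2. The count of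
    leaves left over is an integer below 1, hence there are none. *)
Lemma hub_slack : exists2 c, hub u = [set c] & leaf u = nbr (nbhd u) c /\
  [/\ (l - 1) * (X - l) < 1 / 2, defectT < 1 / 2, defectZ < 1 / 2,
      (degU c - 1) * (1 - x c) < 1 / 2 & defectW < 1 / 2 /\ edgesW < 1].
Proof.
have DE0 := defectW_ge0; have T0 := defectT_ge0; have Z0 := defectZ_ge0.
have lX := weight_nbhd_ge; have W0 := edgesW_ge0.
have sl := total_slack.
have lX0 : 0 <= (l - 1) * (X - l) by rewrite mulr_ge0; move: l10 lX; lra.
have leafs := hub_leaf_count R u gemG.
(* The subtracted half degrees are paid by the leaves, 1/2 each. *)
have hubE : \sum_(c in hub u) (degU c / 2 - (degU c - 1) * x c) =
  \sum_(c in hub u) (1 + (degU c - 1) * (1 - x c))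
  - (\sum_(c in hub u) degU c) / 2.
  by rewrite mulr_suml -sumrB; apply: eq_bigr => c _; field.
have h1 : (#|hub u| = 1)%N.
  have : #|hub u|%:R <= \sum_(c in hub u) (1 + (degU c - 1) * (1 - x c)).
    rewrite -sumr_const; apply: ler_sum => c; rewrite inE => /and3P[_ _ c2].
    by rewrite lerDl mulr_ge0 ?subr_ge0 // ler1n ltnW.
  move=> H; have : (#|hub u| < 2)%N.
    rewrite -(ltr_nat R).
    move: sl lX0 H leafs; rewrite hubE; set a := (l - 1) * _.
    set b := \sum_(c in hub u) degU c; set e := \sum_(c in hub u) _; lra.
  by have := hub_neq0; rewrite -cards_eq0; case: #|hub u| => [|[|]].
have /cards1P[c hubc] : #|hub u| == 1%N by rewrite h1.
exists c => //.
move: sl leafs; rewrite hubE hubc !big_set1 => sl leafs.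
have c1 : 1 <= degU c.
  have : c \in hub u by rewrite hubc set11.
  by rewrite inE ler1n => /and3P[_ _ /ltnW].
have P0 : 0 <= (degU c - 1) * (1 - x c) by rewrite mulr_ge0 ?subr_ge0.
have cL : (#|leaf u| <= #|nbr (nbhd u) c|)%N.
  rewrite -ltnS -(ltr_nat R) -natr1 -/(degU c).
  move: sl lX0 P0; set a := (l - 1) * _; set b := (degU c - 1) * _; lra.
split.
  apply/esym/eqP; rewrite eqEcard cL andbT; apply/fintype.subsetP => y.
  by apply: (hub_leaf gemG); rewrite hubc set11.
have : (l - 1) * (X - l) + defectT + defectZ + (degU c - 1) * (1 - x c)
    + defectW + edgesW / 2 < 1 / 2.
  by move: sl leafs; set a := (l - 1) * _; set b := (degU c - 1) * _; lra.
move: DE0 T0 Z0 W0 lX0 P0.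
by set a := (l - 1) * _; set b := (degU c - 1) * _; repeat split; lra.
Qed.


Lemma missing_weight (A : {set G}) w : A \subset nbhd u ->
  \sum_(y in A) x y <=
  \sum_(y in nbr A w) x y + (X - \sum_(y in nbr (nbhd u) w) x y).
Proof.
move=> AU.
have E (B : {set G}) : \sum_(y in B) x y =
    \sum_(y in nbr B w) x y + \sum_(y in B | ~~ adj w y) x y.
  rewrite (bigID (adj w)) /=; congr (_ + _).
  by apply: eq_bigl => y; rewrite in_nbr.
rewrite E [X in _ + (X - _)]E lerD2l addrC addKr.
rewrite big_mkcond [leRHS]big_mkcond; apply: ler_sum => y _.
have := fintype.subsetP AU y; case: (y \in A) => [->//|_] /=.
by case: ifP.
Qed.

(** Since y <= k / l, the product k (1 - y) is small only for k near 0 or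
    k near l; the first is excluded by k >= 1. *)
Lemma near_full_degree (k y : R) :
  1 <= k -> k * (1 - y) < 1 / 2 -> l * y <= k -> y <= 1 ->
  9 / 10 < y /\ l * (1 - y) < 5 / 9.
Proof.
move=> k1 ky lyk y1.
have y12 : 1 / 2 < y by nra.
have k5 : 5 < k by move: l10; nra.
have y9 : 9 / 10 < y by nra.
split=> //.
have : (l * y) * (1 - y) <= k * (1 - y) by rewrite ler_wpM2r ?subr_ge0.
have : l * (1 - y) * (9 / 10) <= l * (1 - y) * y.
  by rewrite ler_wpM2l ?(ltW y9) // mulr_ge0 ?subr_ge0 //; move: l10; lra.
lra.
Qed.

(** A far vertex w would miss less than 31/50 of the weight of the
    neighbourhood. A triangle would lose two vertices of total weight above 3/2
    and the hub weighs more than 31/50, so there are no triangles and w sees the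
    hub; but then it sees none of the leaves, which hold most of the weight. *)
Lemma far_empty : far u = finset.set0.
Proof.
have [c hubc [leafc [slX slT slZ slc [slD slW]]]] := hub_slack.
have lX := weight_nbhd_ge.
have cB : c \in hub u by rewrite hubc set11.
have [uc cT c2] : [/\ c \in nbhd u, ~~ in_triangle u c & (1 < #|nbr (nbhd u) c|)%N].
  by move: cB; rewrite inE => /and3P.
have c1 : 1 <= degU c by rewrite ler1n ltnW.
apply/eqP; rewrite -[_ == _]negbK; apply/negP => /set0Pn[w wW].
have far0 : nbr (far u) w = finset.set0.
  apply/eqP; rewrite -cards_eq0 -leqn0 -ltnS -(ltr_nat R) -/(deg R (far u) w).
  exact: le_lt_trans (deg_far_le wW) slW.
have k1 : 1 <= degU w.
  rewrite ler1n card_gt0; apply/set0Pn; have [y wy] := isoG w; exists y.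
  rewrite in_nbr wy andbT; have : y \notin nbr (far u) w by rewrite far0 inE.
  rewrite in_nbr wy andbT !inE negb_and !negbK => /orP[/eqP yu|//].
  by move: wW; rewrite !inE -yu adj_sym wy andbF.
have kx : degU w * (1 - x w) < 1 / 2.
  apply: le_lt_trans slD; rewrite (bigD1 w) //= lerDl sumr_ge0 // => v _.
  by rewrite mulr_ge0 ?deg_ge0 ?subr_ge0.
pose S := \sum_(y in nbr (nbhd u) w) x y.
have lS : l * x w <= S.
  by have := weight_far wW; rewrite /deg far0 cards0 addr0.
have lk : l * x w <= degU w by apply: le_trans lS _; apply: sum_le_card.
have [xw lw] := near_full_degree k1 kx lk (x1 w).
have miss : X - S < 31 / 50.
  have : X - l < 1 / 18 by move: l10 lX slX; nra.
  move: lS lw; rewrite mulrBr mulr1; lra.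
have tri0 : tri u = finset.set0.
  apply/eqP; rewrite -[_ == _]negbK; apply/negP => /set0Pn[v vT].
  have [uv vT'] : v \in nbhd u /\ in_triangle u v by move: vT; rewrite inE => /andP.
  set C := [set y in nbhd u | (y == v) || adj v y].
  have CE : C = v |: nbr (nbhd u) v.
    apply/setP => y; rewrite !inE andb_orr; congr (_ || _).
    by case: eqP => [->|]; rewrite ?andbF // -in_nbhd uv.
  have C3 : #|C| = 3%N by rewrite CE cardsU1 triangle_deg // !inE adj_irrefl andbF.
  have CU : C \subset nbhd u by apply/fintype.subsetP => y; rewrite inE => /andP[].
  have CT : C \subset tri u.
    apply/fintype.subsetP => y; rewrite CE in_setU1 => /orP[/eqP->//|vy].
    rewrite inE (triangle_closed gemG uv vT' vy) andbT.
    by move: vy; rewrite in_nbr => /andP[].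
  have H1 : \sum_(y in C) (1 - x y) <= defectT.
    rewrite [leRHS](big_setID C) /= (finset.setIidPr CT) lerDl sumr_ge0 // => y _.
    by rewrite subr_ge0.
  have := missing_weight w CU.
  have : \sum_(y in nbr C w) x y <= 1.
    apply: (le_trans (sum_le_card _)); rewrite lern1.
    apply: leq_trans (far_triangle_nbrs gemG wW uv vT').
    apply: subset_leq_card; apply/fintype.subsetP => y.
    by rewrite !inE => /andP[/andP[-> ->] ->].
  move: H1; rewrite sumrB sumr_const C3 -/S.
  move: slT miss.
  set d := \sum_(y in C) _; set e := \sum_(y in nbr C w) _; lra.
(* The hub therefore has at least l - 3/2 leaves, and its weight is near 1. *)
have XE : X <= 3 / 2 + degU c.
  rewrite sum_nbhd_classes // tri0 big_set0 add0r hubc big_set1 leafc.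
  have := sum_le_card (nbr (nbhd u) c); have := x1 c.
  by move: slZ; rewrite -/(deg R _ c); lra.
have xc : 31 / 50 < x c by move: slc (x1 c) XE lX l10; nra.
have wc : adj w c.
  apply: contraT => wc.
  have := @missing_weight [set c] w; rewrite finset.sub1set uc big_set1 => /(_ isT).
  rewrite big1 -/S; last first.
    by move=> y; rewrite in_nbr inE => /andP[/eqP-> wc']; rewrite wc' in wc.
  by move: miss xc; lra.
have leaf0 : nbr (leaf u) w = finset.set0.
  apply/setP => y; rewrite leafc !in_nbr [RHS]inE.
  apply/negP => /andP[/andP[uy cy] wy].
  have [z cz zy] : exists2 z, z \in nbr (nbhd u) c & z != y.
    have [a [b [ca cb ab]]] := card_ge2P c2.
    by case: (eqVneq a y) => [E|]; [exists b; rewrite // -E eq_sym | exists a].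
  move: cz; rewrite in_nbr => /andP[uz cz].
  have := far_misses_edge gemG wW uy uc uz cy cz zy wc.
  by rewrite wy.
have := weight_nbr_classes w; rewrite -/S leaf0 big_set0 addr0.
have -> : nbr (tri u) w = finset.set0 by apply/setP => y; rewrite tri0 !inE.
have -> : \sum_(y in nbr (hub u) w) x y = x c.
  rewrite (_ : nbr _ w = [set c]) ?big_set1 //.
  by apply/setP => y; rewrite in_nbr hubc !inE; case: eqP => // ->.
rewrite cards0 add0r.
have := x1 c; move: slZ lS (xw) (l10).
have : 10 * (9 / 10) <= l * x w by apply: ler_pM => //; move: l10 xw; lra.
lra.
Qed.

(** With no far vertices, a triangle vertex has degree three, hence weight at
    most 3 / l, against a triangle defect below 1/2. *)
Lemma book_structure : exists2 c, hub u = [set c] &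
  [/\ leaf u = nbr (nbhd u) c, far u = finset.set0 & tri u = finset.set0].
Proof.
have [c hubc [leafc [slX slT slZ slc [slD slW]]]] := hub_slack; exists c => //.
have far0 := far_empty; split => //.
apply/eqP; rewrite -[_ == _]negbK; apply/negP => /set0Pn[v vT].
have [uv vT'] : v \in nbhd u /\ in_triangle u v by move: vT; rewrite inE => /andP.
have xv : l * x v <= 3.
  apply: (le_trans (lx v)); rewrite (sum_nbhd_split u) -in_nbhd uv xu mulr1.
  rewrite [X in _ + X]big1; last by move=> y; rewrite in_nbr far0 inE.
  have := sum_le_card (nbr (nbhd u) v); rewrite triangle_deg //=; lra.
have H1 : 1 - x v <= defectT.
  by rewrite (bigD1 v) //= lerDl sumr_ge0 // => y _; rewrite subr_ge0.
have : 10 * x v <= l * x v by rewrite ler_wpM2r.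
by move: slT H1 xv; lra.
Qed.

End DominantVertex.

(** * Books with pendant edges *)

Lemma graph_iso_sym (G H : sgraph) : graph_iso G H -> graph_iso H G.
Proof.
case=> f [g fK gK] fa; exists g; first by exists f.
by move=> x y; rewrite -fa !gK.
Qed.

Lemma graph_iso_trans (G H K : sgraph) :
  graph_iso G H -> graph_iso H K -> graph_iso G K.
Proof.
case=> f fb fa [g gb ga]; exists (g \o f); first exact: bij_comp.
by move=> x y /=; rewrite ga fa.
Qed.

Lemma S2_minus0 n : graph_iso (S_graph n 2) (S2_minus n 0).
Proof.
exists id; first by exists id.
by move=> [x|x] [y|y] //=; rewrite /delete_adj /= ?andbF ?andbT.
Qed.

(** The hub c loses its edges to the single vertices, so it corresponds to the
    clique vertex 0 of S2_minus. The independent set is enumerated with the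
    single vertices first, because S2_minus deletes the edges to the first
    vertices of that set. *)
Lemma book_iso (G : sgraph) (u c : G) n :
  hub u = [set c] -> leaf u = nbr (nbhd u) c ->
  far u = finset.set0 -> tri u = finset.set0 ->
  (n - 2 = #|lone u| + #|leaf u|)%N ->
  graph_iso G (S2_minus n #|lone u|).
Proof.
move=> hubc leafc far0 tri0 nE; apply: graph_iso_sym.
have allv v : v != u -> adj u v.
  by move=> vu; have := finset.in_set0 v; rewrite -far0 inE vu /= => /negbFE.
have uc : adj u c by have := set11 c; rewrite -hubc inE in_nbhd => /andP[].
pose s := enum (lone u) ++ enum (leaf u).
have in_s v : (v \in s) = (v \in lone u) || (v \in leaf u).
  by rewrite mem_cat !mem_enum.
have loneN v y : v \in lone u -> adj u y -> adj v y = false.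
  rewrite inE cards_eq0 => /andP[_ /eqP v0] uy; apply/negP => vy.
  by have := finset.in_set0 y; rewrite -v0 in_nbr in_nbhd uy vy.
have leafN v y : v \in leaf u -> adj u y -> adj v y = (y == c).
  move=> vL uy; have vc : adj v c.
    by move: vL; rewrite leafc in_nbr adj_sym => /andP[].
  move: vL; rewrite inE => /and3P[_ _ /cards1P[z vz]].
  have zc : z = c.
    by have := finset.in_set1 c z; rewrite -vz in_nbr in_nbhd uc vc => /esym/eqP.
  by have := finset.in_set1 y z; rewrite -vz in_nbr in_nbhd uy zc.
have sU v : v \in s -> adj u v.
  by rewrite in_s => /orP[]; rewrite inE in_nbhd => /andP[].
have cs : c \notin s.
  rewrite in_s; have := set11 c; rewrite -hubc !inE => /and3P[_ _ c2].
  by case: #|_| c2 => [|[|k]] //= _; rewrite !andbF.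
have us : uniq s.
  rewrite cat_uniq !enum_uniq andbT /=; apply/hasPn => v.
  rewrite !mem_enum !inE => /and3P[_ _ /eqP->]; by rewrite andbF.
have ss : size s = (n - 2)%N by rewrite size_cat -!cardE nE.
pose g (z : S2_minus n #|lone u|) : G :=
  match z with inl i => if (i == 0 :> nat)%N then c else u
  | inr j => nth u s j end.
have nths (j : 'I_(n - 2)) : nth u s j \in s by rewrite mem_nth // ss.
have sc (j : 'I_(n - 2)) : nth u s j != c.
  by apply: contraNneq cs => <-.
have su (j : 'I_(n - 2)) : nth u s j != u.
  by apply/eqP => E; have := sU _ (nths j); rewrite E adj_irrefl.
have cu : c != u by rewrite eq_sym; apply: adj_neq.
have I2 (i : 'I_2) : i = (if (i == 0 :> nat)%N then ord0 else ord_max).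
  by apply/val_inj; case: i => [[|[|]]].
have gi : injective g.
  move=> [i|i] [j|j] /=.
  - move=> E; congr inl; rewrite (I2 i) (I2 j); move: E.
    by case: ifP => _; case: ifP => _ // E; rewrite E eqxx in cu.
  - by case: ifP => _ /esym/eqP E; [have := sc j | have := su j]; rewrite E.
  - by case: ifP => _ /eqP E; [have := sc i | have := su i]; rewrite E.
  by move=> /eqP; rewrite nth_uniq ?ss // => /eqP/val_inj->.
exists g.
  apply: inj_card_bij gi _; rewrite card_sum !card_ord -ss cardE.
  apply: (@uniq_leq_size _ _ [:: u, c & s]) (enum_uniq _) _ => v _.
  rewrite !inE; case: (eqVneq v u) => //= /allv; rewrite -in_nbhd => uv.
  have := finset.in_set0 v; rewrite -tri0 inE uv /= => vT.
  have := finset.in_set1 v c; rewrite -hubc inE uv vT /= => <-.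
  rewrite in_s !inE -in_nbhd uv vT /=; by case: #|_| => [|[|]].
have cadj (j : 'I_(n - 2)) : adj c (nth u s j) = ~~ (j < #|lone u|)%N.
  rewrite adj_sym nth_cat -cardE; case: ltnP => jt.
    by rewrite loneN // -mem_enum mem_nth // -cardE.
  rewrite leafN ?eqxx // -mem_enum mem_nth // -cardE.
  by rewrite ltn_subLR // -nE.
move=> [i|i] [j|j] /=; rewrite /delete_adj /= /complete_adj /edgeless_adj ?andbT ?orbF.
- rewrite (I2 i) (I2 j); case: (i == 0 :> nat)%N; case: (j == 0 :> nat)%N => /=;
    by rewrite ?adj_irrefl ?eqxx // 1?adj_sym uc.
- by case: (i == 0 :> nat)%N; rewrite ?cadj // sU.
- by rewrite adj_sym; case: (j == 0 :> nat)%N; rewrite ?cadj // sU.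
have jU := sU _ (nths j).
have := nths i; rewrite in_s => /orP[iL|iL]; first by rewrite loneN.
by rewrite leafN // (negbTE (sc j)).
Qed.

Section Eigen.

Variable R : realType.

(** Eigenvectors seen as weights on the vertices; symmetry of the adjacency
    matrix makes row eigenvectors and this form agree. *)
Lemma eigen_weightP (G : sgraph) (a : R) :
  eigenvalue (adjacency_matrix R G) a <->
  exists2 x : G -> R, (exists v, x v != 0) &
    forall v, a * x v = \sum_(y in nbhd v) x y.
Proof.
have sumE (z : 'rV[R]_#|G|) v :
    (z *m adjacency_matrix R G) 0 (enum_rank v) =
    \sum_(y in nbhd v) z 0 (enum_rank y).
  rewrite mxE (reindex _ (onW_bij _ (enum_rank_bij G))) /= [RHS]big_mkcond.
  apply: eq_bigr => y _; rewrite mxE !enum_rankK in_nbhd adj_sym.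
  by case: adj; rewrite ?mulr1 ?mulr0.
split=> [/eigenvalueP[z zA z0]|[x [v xv] xA]].
  exists (fun v => z 0 (enum_rank v)); last by move=> v; rewrite -sumE zA mxE.
  have /rV0Pn[i zi] := z0; by exists (enum_val i); rewrite enum_valK.
apply/eigenvalueP; exists (\row_i x (enum_val i)).
  apply/rowP => i; rewrite -(enum_valK i) sumE !mxE enum_rankK xA.
  by apply: eq_bigr => y _; rewrite mxE enum_rankK.
by apply/rV0Pn; exists (enum_rank v); rewrite mxE enum_rankK.
Qed.

Lemma iso_eigenvalue (G H : sgraph) (a : R) : graph_iso G H ->
  eigenvalue (adjacency_matrix R G) a -> eigenvalue (adjacency_matrix R H) a.
Proof.
case=> f [g fK gK] fa /eigen_weightP[x [v xv] xA]; apply/eigen_weightP.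
exists (x \o g); first by exists (f v); rewrite /= fK.
move=> w /=; rewrite xA (reindex g) /=; last by exists f => y _; rewrite ?fK ?gK.
by apply: eq_bigl => y; rewrite !in_nbhd -fa !gK.
Qed.

Lemma sum_ord_ge N t (a b : R) : (t <= N)%N ->
  \sum_(j < N) (a + (~~ (j < t)%N)%:R * b) = N%:R * a + (N - t)%:R * b.
Proof.
move=> tN; rewrite big_split /= sumr_const card_ord mulr_natl; congr (_ + _).
rewrite -mulr_suml -natr_sum; congr (_%:R * _).
rewrite -(big_mkord xpredT (fun j => nat_of_bool (~~ (j < t)%N))).
rewrite (big_cat_nat (n := t)) //= big_nat big1 ?add0n; last by move=> j /andP[_ ->].
rewrite big_nat (eq_bigr (fun _ => 1%N)) -?big_nat ?sum_nat_const_nat ?muln1 //.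
by move=> j /andP[tj _]; rewrite ltnNge tj.
Qed.

(** Eliminating the weights of the independent set leaves a 2 by 2 system for
    the weights p and q of the clique vertices, where p belongs to the vertex that
    loses t edges; the quartic is its determinant. *)
Lemma S2_minus_eigenvalue n t (l : R) : (t <= n - 2)%N -> 0 < l ->
  let k : R := (n - 2 - t)%:R in
  eigenvalue (adjacency_matrix R (S2_minus n t)) l <->
  l ^+ 4 - l ^+ 2 - (2 * k + t%:R) * (l ^+ 2 + l) + t%:R * (l + k) = 0.
Proof.
move=> tN l0 k.
pose H := S2_minus n t.
pose hub0 : H := inl ord0; pose hub1 : H := inl ord_max.
pose page (j : 'I_(n - 2)) : H := inr j.
have kE : (n - 2)%:R = k + t%:R :> R by rewrite -natrD subnK.
have sumH (F : H -> R) : \sum_v F v = F hub0 + F hub1 + \sum_(j < n - 2) F (page j).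
  rewrite big_sumType /= big_ord_recl big_ord1; congr (_ + _ + _).
  by congr F; congr inl; apply/val_inj.
have nb (F : H -> R) v : \sum_(y in nbhd v) F y = \sum_y (adj v y)%:R * F y.
  rewrite big_mkcond; apply: eq_bigr => y _; rewrite in_nbhd.
  by case: adj; rewrite ?mul1r ?mul0r.
have nb0 (F : H -> R) : \sum_(y in nbhd hub0) F y =
    F hub1 + \sum_(j < n - 2) (~~ (j < t)%N)%:R * F (page j).
  by rewrite nb sumH /= /delete_adj /= mul0r mul1r add0r; under eq_bigr do rewrite orbF.
have nb1 (F : H -> R) : \sum_(y in nbhd hub1) F y =
    F hub0 + \sum_(j < n - 2) F (page j).
  by rewrite nb sumH /= /delete_adj /= mul0r mul1r addr0; under eq_bigr do rewrite mul1r.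
have nbp (F : H -> R) j : \sum_(y in nbhd (page j)) F y =
    F hub1 + (~~ (j < t)%N)%:R * F hub0.
  rewrite nb sumH /= /delete_adj /= mul1r [F hub1 + _]addrC big1 ?addr0 //.
  by move=> i _; rewrite mul0r.
have allH (P : H -> Prop) : P hub0 -> P hub1 -> (forall j, P (page j)) -> forall v, P v.
  move=> P0 P1 Pp [[[|[|i]] ii]|j] //.
  - by rewrite (_ : Ordinal ii = ord0) //; apply/val_inj.
  by rewrite (_ : Ordinal ii = ord_max) //; apply/val_inj.
have bb (b : bool) : b%:R * b%:R = b%:R :> R by case: b; rewrite ?mulr1 ?mulr0.
split=> [/eigen_weightP[x [v xv] xA]|E].
  pose p := x hub0; pose q := x hub1.
  have Ep : l ^+ 2 * p = l * q + k * (p + q).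
    have := congr1 (fun z => l * z) (xA hub0); rewrite nb0 mulrDr mulr_sumr.
    rewrite (eq_bigr (fun j : 'I_(n-2) => 0 + (~~ (j < t)%N)%:R * (p + q))).
      by rewrite sum_ord_ge // mulr0 add0r -/k -/p -/q mulrA => ->.
    move=> j _; rewrite mulrCA xA nbp -/p -/q mulrDr mulrA bb; ring.
  have Eq : l ^+ 2 * q = l * p + (k + t%:R) * q + k * p.
    have := congr1 (fun z => l * z) (xA hub1); rewrite nb1 mulrDr mulr_sumr.
    rewrite (eq_bigr (fun j : 'I_(n-2) => q + (~~ (j < t)%N)%:R * p)).
      by rewrite sum_ord_ge // kE -/k -/p -/q mulrA -addrA => ->.
    by move=> j _; rewrite xA nbp.
  (* The difference of the two equations: only the t deleted edges remain. *)
  have Epq : (l ^+ 2 + l) * (q - p) = t%:R * q by nra.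
  have l1 : 0 < l ^+ 2 + l by rewrite addr_gt0 ?exprn_gt0.
  have q0 : q != 0.
    apply/eqP => q0; case/negP: xv; apply/eqP; move: v.
    have p0 : p = 0.
      move: Epq; rewrite q0 mulr0 sub0r => /eqP.
      by rewrite mulf_eq0 oppr_eq0 (gt_eqF l1) /= => /eqP.
    apply: allH => // j; have /eqP := xA (page j).
    by rewrite nbp -/p -/q p0 q0 mulr0 addr0 mulf_eq0 (gt_eqF l0) /= => /eqP.
  apply: (mulfI q0); rewrite mulr0.
  have : (l ^+ 2 + l) * p = (l ^+ 2 + l) * q - t%:R * q by rewrite -Epq; ring.
  move: (congr1 (fun z => (l ^+ 2 + l) * z) Eq) => E1 E2.
  have : (l ^+ 2 + l) * (l ^+ 2 * q) =
    (l + k) * ((l ^+ 2 + l) * p) + (l ^+ 2 + l) * (k + t%:R) * q.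
    by rewrite E1; ring.
  rewrite E2 => E3.
  transitivity ((l ^+ 2 + l) * (l ^+ 2 * q)
    - ((l + k) * ((l ^+ 2 + l) * q - t%:R * q) + (l ^+ 2 + l) * (k + t%:R) * q)).
    ring.
  by rewrite E3 subrr.
apply/eigen_weightP.
(* Solved from the equations and scaled by l (l^2 + l) to avoid division. *)
pose x (v : H) : R := match v with
  | inl i => if (i == 0 :> nat)%N then l * (l ^+ 2 + l - t%:R) else l * (l ^+ 2 + l)
  | inr j => (l ^+ 2 + l) + (~~ (j < t)%N)%:R * (l ^+ 2 + l - t%:R) end.
exists x.
  by exists hub1; rewrite /x /= gt_eqF // mulr_gt0 // addr_gt0 ?exprn_gt0.
apply: allH.
- rewrite nb0 /x /=.
  rewrite (eq_bigr (fun j : 'I_(n - 2) =>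
    0 + (~~ (j < t)%N)%:R * (l ^+ 2 + l + (l ^+ 2 + l - t%:R)))).
    rewrite sum_ord_ge // -/k mulr0; apply: subr0_eq; rewrite -[RHS]E; ring.
  by move=> j _; case: (j < t)%N => /=; ring.
- rewrite nb1 /x /= sum_ord_ge // kE -/k; apply: subr0_eq; rewrite -[RHS]E; ring.
by move=> j; rewrite nbp /x /=; ring.
Qed.

End Eigen.

(** * Eigenvalues above the bound *)

Section Extremal.

Variable R : realType.

(** By the triangle inequality, absolute values of an eigenvector satisfy the
    eigenvalue equation as an inequality. *)
Lemma eigen_dominant_weight (G : sgraph) (l : R) :
  0 < l -> eigenvalue (adjacency_matrix R G) l ->
  exists (x : G -> R) (u : G), [/\ forall v, 0 <= x v, forall v, x v <= 1,
    x u = 1 & subeigen l x].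
Proof.
move=> l0 /eigen_weightP[z [v0 zv0] zA].
case: (@arg_maxP _ _ _ v0 xpredT (fun v => `|z v|)) => // u _ umax.
have zu : 0 < `|z u|.
  by apply: lt_le_trans (umax v0 isT); rewrite normr_gt0.
exists (fun v => `|z v| / `|z u|), u; split.
- by move=> v; rewrite divr_ge0.
- by move=> v; rewrite ler_pdivrMr // mul1r; apply: umax.
- by rewrite divff // gt_eqF.
move=> v; rewrite mulrA -mulr_suml ler_wpM2r ?invr_ge0 ?(ltW zu) //.
by rewrite -{1}(gtr0_norm l0) -normrM zA; apply: ler_norm_sum.
Qed.

Lemma large_eigenvalue_book (G : sgraph) (l : R) :
  gem_free G -> no_isolated_vertex G -> 10 <= l ->
  (graph_size G)%:R < l ^+ 2 - l + 3 / 2 ->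
  eigenvalue (adjacency_matrix R G) l ->
  exists k t : nat, [/\ graph_size G = (2 * k + t + 1)%N,
    graph_iso G (S2_minus (k + t + 2) t) &
    l ^+ 4 - l ^+ 2 - (2 * k%:R + t%:R) * (l ^+ 2 + l) + t%:R * (l + k%:R) = 0].
Proof.
move=> gemG isoG l10 sizeG lG; have l0 : 0 < l by lra.
have [x [u [x0 x1 xu lx]]] := eigen_dominant_weight l0 lG.
have [c hubc [leafc far0 tri0]] := book_structure gemG isoG l10 x0 x1 xu lx sizeG.
have nE : (#|leaf u| + #|lone u| + 2 - 2 = #|lone u| + #|leaf u|)%N.
  by rewrite addnK addnC.
have iG := book_iso hubc leafc far0 tri0 nE.
exists #|leaf u|, #|lone u|; split=> //.
  apply/eqP; rewrite -(eqr_nat R) (size_split R u) far0 !big_set0.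
  have -> : #|nbhd u|%:R = \sum_(v in nbhd u) 1 :> R by rewrite sumr_const.
  rewrite !sum_nbhd_classes // tri0 hubc !big_set0 !big_set1 !sumr_const.
  rewrite big1; last by move=> v; rewrite inE /deg => /andP[_ /eqP->].
  rewrite (eq_bigr (fun _ => 1)); last first.
    by move=> v; rewrite inE /deg => /and3P[_ _ /eqP->].
  by rewrite sumr_const /deg -leafc 2!natrD natrM; apply/eqP; field.
have := iso_eigenvalue iG lG; rewrite S2_minus_eigenvalue ?nE ?leq_addr //.
by rewrite addnC addnK.
Qed.

Lemma largestE (A : set R) a : A a -> (forall b, A b -> b <= a) -> largest A = a.
Proof.
move=> Aa ub; apply: xget_unique; first by split.
by move=> b [Ab bub]; apply/eqP; rewrite eq_le ub //= bub.
Qed.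

Lemma largestP (A : set R) :
  (A (largest A) /\ forall b, A b -> b <= largest A) \/ largest A = 0.
Proof. by rewrite /largest; case: xgetP => [a _ []|]; [left | right]. Qed.

Lemma rho_star_polyE m (x : R) : (rho_star_poly R m).[x] =
  x ^+ 4 - m%:R * x ^+ 2 - (m%:R - 2) * x + (m%:R / 2 - 1).
Proof. by rewrite !hornerE. Qed.

(** With D = m - 1 - x^2 + x the hypothesis reads 2 D (x^2 + x) <= x^2 + x - 1 + D,
    which forces D < 1/2. *)
Lemma rho_star_poly_ge0 (m : nat) (x : R) : 10 <= x ->
  0 <= (rho_star_poly R m).[x] -> m%:R < x ^+ 2 - x + 3 / 2.
Proof.
move=> x10; rewrite rho_star_polyE => px.
rewrite ltNge; apply/negP => H.
have : 0 <= (2 * (x ^+ 2 + x) - 1) * (m%:R - (x ^+ 2 - x + 3 / 2)).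
  by rewrite mulr_ge0 ?subr_ge0 //; nra.
nra.
Qed.

(** The polynomial is negative at 10 as soon as m >= 92, and positive at m.
    A root a >= 10 satisfies a^2 > m + a - 3/2, so the other factor of the
    polynomial is positive beyond a, which makes a the largest root. *)
Lemma rho_starP m : (92 <= m)%N ->
  [/\ 10 <= rho_star R m, root (rho_star_poly R m) (rho_star R m)
    & forall x, rho_star R m < x -> 0 < (rho_star_poly R m).[x]].
Proof.
move=> m92; have m92R : 92 <= m%:R :> R by rewrite ler_nat.
have [a /andP[a10 am] ra] : exists2 a, 10 <= a <= m%:R &
    root (rho_star_poly R m) a.
  apply: poly_ivt; first by lra.
  rewrite !rho_star_polyE; apply/andP; split; first by nra.
  have : 0 <= (m%:R : R) ^+ 2 * (m%:R ^+ 2 - m%:R - 1) by rewrite mulr_ge0 ?sqr_ge0 //; nra.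
  nra.
have pa : (rho_star_poly R m).[a] = 0 by apply/eqP.
have up x : a < x -> 0 < (rho_star_poly R m).[x].
  move=> ax; have ma := @rho_star_poly_ge0 m a a10.
  rewrite pa lexx in ma; have {}ma := ma isT.
  have -> : (rho_star_poly R m).[x] = (x - a) *
      ((x + a) * (x ^+ 2 + a ^+ 2 - m%:R) - (m%:R - 2)).
    by rewrite -[LHS]subr0 -pa !rho_star_polyE; ring.
  rewrite mulr_gt0 ?subr_gt0 //.
  have : 20 * (a ^+ 2 + a - 3 / 2) <= (x + a) * (x ^+ 2 + a ^+ 2 - m%:R).
    by apply: ler_pM; nra.
  nra.
have -> : rho_star R m = a; last by [].
apply: largestE => // b /= rb; rewrite leNgt; apply/negP => /up.
by move: rb => /rootP ->; rewrite ltxx.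
Qed.

(** The lower bound 10 comes from 4 * 92 - 3 = 365 > 19^2. *)
Lemma odd_boundP (m : nat) : (92 <= m)%N ->
  let b : R := (1 + Num.sqrt (4 * m%:R - 3)) / 2 in
  10 <= b /\ b ^+ 2 - b = m%:R - 1.
Proof.
move=> m92 b; have m92R : 92 <= m%:R :> R by rewrite ler_nat.
have s0 : 0 <= 4 * m%:R - 3 :> R by lra.
have sE := sqr_sqrtr s0.
split; last by rewrite /b; move: sE; set s := Num.sqrt _; nra.
have : 19 <= Num.sqrt (4 * m%:R - 3) :> R.
  rewrite -[leLHS]ger0_norm // -sqrtr_sqr ler_sqrt //; nra.
rewrite /b; lra.
Qed.

(** With D = m - 1 - l^2 + l < 1/2 the quartic says (l^2 + l) D = t (l + k).
    This bounds t by about l / 2, so that 2 k is close to l^2, and then three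
    pendant edges already make the right side about 3 l^2 / 2, while the left side is below
    (l^2 + l) / 2. *)
Lemma even_no_three_pendants (l k t : R) :
  10 <= l -> 3 <= t -> 0 <= k ->
  2 * k + t + 1 < l ^+ 2 - l + 3 / 2 ->
  l ^+ 4 - l ^+ 2 - (2 * k + t) * (l ^+ 2 + l) + t * (l + k) = 0 -> False.
Proof.
move=> l10 t3 k0 ml E.
pose D := 2 * k + t - l ^+ 2 + l.
have D2 : D < 1 / 2 by rewrite /D; lra.
have ED : (l ^+ 2 + l) * D = t * (l + k) by rewrite /D; nra.
have lD : (l ^+ 2 + l) * D < (l ^+ 2 + l) * (1 / 2) by rewrite ltr_pM2l //; nra.
have D0 : 0 <= D.
  by rewrite -(@pmulr_rge0 _ (l ^+ 2 + l)) ?ED ?mulr_ge0; nra.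
have tl : t < (l + 1) / 2.
  rewrite -(@ltr_pM2l _ l); last by lra.
  have : 0 <= t * k by rewrite mulr_ge0 //; lra.
  by move: lD; rewrite ED; nra.
have : 3 * (l + k) <= t * (l + k) by rewrite ler_wpM2r //; lra.
by move: lD; rewrite ED => *; rewrite /D in D0; nra.
Qed.

Definition bound (m : nat) : R :=
  if odd m then (1 + Num.sqrt (4 * m%:R - 3)) / 2 else rho_star R m.

Definition extremal (m : nat) : sgraph :=
  if odd m then S_graph ((m + 3) %/ 2) 2 else S2_minus ((m + 4) %/ 2) 1.

Lemma bound_ge10 m : (92 <= m)%N -> 10 <= bound m.
Proof.
move=> m92; rewrite /bound; case: ifP => _.
  by have [] := odd_boundP m92.
by have [] := rho_starP m92.
Qed.

(** Every eigenvalue, and not just the largest one, is covered, so that the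
    bound is later seen to be an upper bound of the whole spectrum. *)
Lemma eigenvalue_ge_bound (G : sgraph) (l : R) :
  (92 <= graph_size G)%N -> gem_free G -> no_isolated_vertex G ->
  eigenvalue (adjacency_matrix R G) l -> bound (graph_size G) <= l ->
  l = bound (graph_size G) /\ graph_iso G (extremal (graph_size G)).
Proof.
move=> m92 gemG isoG lG; have := bound_ge10 m92.
rewrite /bound /extremal; case: ifP => [om|em] b10 bl.
  have [_ bE] := odd_boundP m92.
  set b := (1 + _) / 2 in b10 bl bE *.
  have l10 : 10 <= l by lra.
  have ml : (graph_size G)%:R - 1 <= l ^+ 2 - l by rewrite -bE; nra.
  have ml' : (graph_size G)%:R < l ^+ 2 - l + 3 / 2 by lra.
  have [k [t [mE iG E]]] := large_eigenvalue_book gemG isoG l10 ml' lG.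
  have mR : (graph_size G)%:R = 2 * k%:R + t%:R + 1 :> R.
    by rewrite mE 2!natrD natrM.
  have t0 : t = 0%N.
    have : 0 <= (l ^+ 2 + l) * (l ^+ 2 - l - ((graph_size G)%:R - 1)).
      by rewrite mulr_ge0 ?subr_ge0 //; nra.
    move=> H; have : t%:R * (l + k%:R) <= 0 by rewrite mR in H; nra.
    rewrite pmulr_lle0; last by rewrite (@lt_le_trans _ _ l) ?lerDl //; lra.
    by rewrite lern0 => /eqP.
  rewrite t0 addn0 in mE; rewrite t0 addn0 in iG; split.
    have : (l ^+ 2 + l) * (l ^+ 2 - l - (b ^+ 2 - b)) = 0.
      by rewrite bE mR; move: E; rewrite t0 => E; rewrite -[RHS]E; ring.
    move/eqP; rewrite mulf_eq0 gt_eqF /=; last by nra.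
    by move=> /eqP H; apply/le_anti; rewrite bl andbT; nra.
  have -> : ((graph_size G + 3) %/ 2 = k + 2)%N.
    by rewrite mE; lia.
  exact: graph_iso_trans iG (graph_iso_sym (S2_minus0 _)).
have [_ rb up] := rho_starP m92.
have l10 : 10 <= l by lra.
have pl : 0 <= (rho_star_poly R (graph_size G)).[l].
  move: bl; rewrite le_eqVlt => /orP[/eqP<-|/up/ltW//].
  by rewrite (rootP rb).
have ml := rho_star_poly_ge0 l10 pl.
have [k [t [mE iG E]]] := large_eigenvalue_book gemG isoG l10 ml lG.
have mR : (graph_size G)%:R = 2 * k%:R + t%:R + 1 :> R.
  by rewrite mE 2!natrD natrM.
have t1 : t = 1%N.
  have ot : odd t by move: em; rewrite mE; lia.
  have t3 : (t < 3)%N.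
    rewrite ltnNge; apply/negP => t3.
    apply: (@even_no_three_pendants l k%:R t%:R) => //; first by rewrite ler_nat.
    by rewrite -mR.
  by case: t ot t3 {iG E mE mR} => [|[|[|]]].
rewrite t1 in mE iG E mR; split.
  have pl0 : (rho_star_poly R (graph_size G)).[l] = 0.
    by rewrite rho_star_polyE mR -[RHS]E; field.
  by apply/le_anti; rewrite bl andbT leNgt; apply/negP => /up; rewrite pl0 ltxx.
have -> : ((graph_size G + 4) %/ 2 = k + 1 + 2)%N; last by [].
by rewrite mE; lia.
Qed.

Lemma extremal_eigenvalue m : (92 <= m)%N ->
  eigenvalue (adjacency_matrix R (extremal m)) (bound m).
Proof.
move=> m92; have := bound_ge10 m92; rewrite /bound /extremal.
case: ifP => [om|em] b10.
  apply: (iso_eigenvalue (graph_iso_sym (S2_minus0 _))).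
  have [_ bE] := odd_boundP m92; set b := (1 + _) / 2 in b10 bE *.
  apply/S2_minus_eigenvalue; [by []|lra|].
  have -> : ((m + 3) %/ 2 - 2 - 0 = m./2)%N.
    by rewrite -divn2; lia.
  have mR : m%:R = 1 + 2 * m./2%:R :> R.
    by rewrite -{1}(odd_double_half m) om natrD -mul2n natrM.
  rewrite (_ : _ + _ = (b ^+ 2 + b) * (b ^+ 2 - b - 2 * m./2%:R)).
    by rewrite bE mR; ring.
  by ring.
have [_ /rootP rb _] := rho_starP m92; rewrite rho_star_polyE in rb.
set b := rho_star R m in b10 rb *.
apply/S2_minus_eigenvalue; [lia|lra|].
have [k mE] : exists k, m = (2 * k + 2)%N.
  exists (m./2).-1; have := odd_double_half m; rewrite em -mul2n add0n; lia.
have -> : ((m + 4) %/ 2 - 2 - 1 = k)%N by lia.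
have mR : m%:R = 2 * k%:R + 2 :> R by rewrite mE natrD natrM.
by rewrite -[RHS]rb mR; field.
Qed.

End Extremal.

Theorem theorem1p5 (R : realType) (m : nat) (G : sgraph) :
  (92 <= m)%N ->
  gem_free G ->
  graph_size G = m ->
  no_isolated_vertex G ->
  let bound : R :=
    if odd m then (1 + Num.sqrt (4 * m%:R - 3)) / 2 else rho_star R m in
  let extremal : sgraph :=
    if odd m then S_graph ((m + 3) %/ 2) 2 else S2_minus ((m + 4) %/ 2) 1 in
  spectral_radius R G <= bound /\
  (spectral_radius R G = bound <-> graph_iso G extremal).
Proof.
move=> m92 gemG mG isoG b H.
have b0 : 0 < b by have := bound_ge10 R m92; rewrite /bound -/b; lra.
have big l : eigenvalue (adjacency_matrix R G) l -> b <= l ->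
    l = b /\ graph_iso G H.
  by move=> lG bl; have := @eigenvalue_ge_bound R G l; rewrite mG; apply.
have ub l : eigenvalue (adjacency_matrix R G) l -> l <= b.
  by move=> lG; rewrite leNgt; apply/negP => bl; have [E _] := big l lG (ltW bl);
     rewrite E ltxx in bl.
have := largestP [set a | eigenvalue (adjacency_matrix R G) a]%classic.
rewrite -/(spectral_radius R G) => rP; split.
  by case: rP => [[/= /ub]|->] //; apply: ltW.
split=> [rb|iG].
  case: rP => [[/= rG _]|r0]; last by rewrite -rb r0 ltxx in b0.
  by have [] := big _ rG _; rewrite ?rb.
apply: largestE => [/=|l /= /ub //].
exact: iso_eigenvalue (graph_iso_sym iG) (extremal_eigenvalue R m92).
Qed.
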